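(* Let $\mathcal{G}$ be a locally finite graph with Hashimoto matrix $H$, and let $\mathcal{G}_1\subset\mathcal{G}_2\subset\cdots\subset\mathcal{G}$ be an increasing sequence of finite subgraphs converging to $\mathcal{G}$, with Hashimoto matrices $H_t=H(\mathcal{G}_t)$. Then the limit $$\rho_0\equiv\lim_{t\to\infty}\rho(H_t)$$ exists and satisfies $\rho_0\le\rho_{l^2}(H)$. Moreover, if the oriented line graph of $\mathcal{G}$ is locally strongly $\ell$-connected for some positive integer $\ell$, then $\rho_0=\rho_{l^2}(H)$.
   Context: For a graph $\mathcal{G}$, let $\mathcal{A}(\mathcal{G})$ be its set of arcs (directed edges; each undirected edge gives two mutually reverse arcs $a,\bar a$). The Hashimoto matrix $H$ is indexed by arcs, with $H_{a,b}=1$ iff the head of $a$ coincides with the tail of $b$ and $b\neq\bar a$, and $0$ otherwise; it is the adjacency matrix of the oriented line graph (OLG) of $\mathcal{G}$. $\rho(H_t)$ is the spectral radius of the finite matrix $H_t$, and $\rho_{l^2}(H)=\lim_{m\to\infty}\|H^m\|_2^{1/m}$ is the spectral radius of $H$ as an operator on $l^2(\mathcal{A})$. The sequence converges to $\mathcal{G}$ means every vertex and edge of $\mathcal{G}$ belongs to some $\mathcal{G}_t$. A non-backtracking walk is a sequence of arcs in which each consecutive pair $(a,b)$ has $H_{a,b}=1$. The OLG of $\mathcal{G}$ is called (locally) strongly $\ell$-connected if for every arc $a$ there is a non-backtracking walk of length at most $\ell$ from $a$ to $\bar a$. *)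

(* Defs.v *)
From HB Require Import structures.
From mathcomp Require Import all_boot all_order all_algebra.
From mathcomp Require Import all_classical all_reals all_analysis.
From mathcomp Require Import complex.
Set Implicit Arguments. Unset Strict Implicit. Unset Printing Implicit Defensive.
Import Order.TTheory GRing.Theory Num.Theory.
Local Open Scope classical_set_scope.
Local Open Scope ring_scope.

(* A (simple, undirected) graph on a vertex type V is given by its set of arcs
   E : set (V * V); the arc (u,v) has tail u and head v, its reverse is (v,u).
   E must be symmetric and loop-free. *)
Definition is_graph {V : choiceType} (E : set (V * V)) : Prop :=
  (forall u v, E (u, v) -> E (v, u)) /\ (forall v, ~ E (v, v)).

Definition locally_finite {V : choiceType} (E : set (V * V)) : Prop :=
  forall v, finite_set [set w | E (v, w)].

Definition rev_arc {V : Type} (a : V * V) : V * V := (a.2, a.1).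

Definition hash_rel {V : choiceType} (E : set (V * V)) (a b : V * V) : Prop :=
  E a /\ E b /\ a.2 = b.1 /\ b <> rev_arc a.

Definition hashimoto {V : choiceType} {K : pzRingType} (E : set (V * V))
  (a b : V * V) : K := if `[< hash_rel E a b >] then 1 else 0.

(* Finite matrix case: spectral radius = max modulus of the (complex)
   eigenvalues of H acting on functions A -> C (A a finite set of arcs). *)
Definition hash_eigenvalue {R : realType} {V : choiceType} (A : set (V * V))
  (lam : R[i]) : Prop :=
  exists x : V * V -> R[i],
    (exists a, A a /\ x a != 0) /\ (forall a, ~ A a -> x a = 0) /\
    forall a, A a -> \sum_(b \in A) hashimoto A a b * x b = lam * x a.

Definition spec_rad {R : realType} {V : choiceType} (A : set (V * V)) : R :=
  sup [set Normc.normc lam | lam in [set lam | @hash_eigenvalue R V A lam]].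

Definition l2sq {R : realType} {V : choiceType} (E : set (V * V))
  (x : V * V -> R) : \bar R := \esum_(a in E) ((x a) ^+ 2)%:E.

Definition hash_op {R : realType} {V : choiceType} (E : set (V * V))
  (x : V * V -> R) : V * V -> R :=
  fun a => \sum_(b \in E) hashimoto E a b * x b.

Definition opnorm_sq {R : realType} {V : choiceType} (E : set (V * V))
  (m : nat) : \bar R :=
  ereal_sup [set l2sq E (iter m (hash_op E) x) |
             x in [set x : V * V -> R | (l2sq E x <= 1)%E]].

Definition rho_l2 {R : realType} {V : choiceType} (E : set (V * V)) : \bar R :=
  limn (fun m : nat => poweR (opnorm_sq E m.+1) (2 * m.+1%:R)^-1).

Definition nb_step {V : choiceType} (E : set (V * V)) : rel (V * V) :=
  fun a b => `[< hash_rel E a b >].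

Definition loc_strongly_connected {V : choiceType} (E : set (V * V)) (l : nat)
  : Prop :=
  forall a, E a -> exists s : seq (V * V),
    path (nb_step E) a s /\ last a s = rev_arc a /\ (size s <= l)%N.

Definition finite_exhaustion {V : choiceType} (E : set (V * V))
  (VS : nat -> set V) (ES : nat -> set (V * V)) : Prop :=
  (forall t, finite_set (VS t)) /\
  (forall t, ES t `<=` E) /\
  (forall t u v, ES t (u, v) -> ES t (v, u)) /\
  (forall t u v, ES t (u, v) -> VS t u /\ VS t v) /\
  (forall t, VS t `<=` VS t.+1) /\ (forall t, ES t `<=` ES t.+1) /\
  (forall v, exists t, VS t v) /\ (forall a, E a -> exists t, ES t a).

(* Main.v *)
(* Write T_A for the Hashimoto operator of the arc set A, P for arc reversal and
   e_m = ||T_E^m||.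

   Gelfand: for finite A, Cayley-Hamilton bounds T_A^n by C r^n for every
   r > rho(A), while the modulus y of an eigenvector for lam satisfies
   |lam| y <= T_A y. Hence rho(H_t) is nondecreasing and at most e_m^(1/m) for
   every m >= 1.

   Convergence of e_m^(1/m): the degrees need not be bounded, so e_m may be
   infinite. If e_m is finite, every arc from which a walk of m - 1 steps starts
   has at most e_m^2 predecessors; hence e_n is finite for all n >= m, and
   Fekete's argument gives the limit inf_m e_m^(1/m).

   Connected case: T_t^m P is symmetric, and replacing each P by an excursion of
   length at most l inside a larger H_t' dominates it by
   sum_(j <= l) T_t'^(m+j). The norm of a symmetric operator is the growth rate
   of its powers, so ||T_t^m|| <= r^m sum_(j <= l) r^j for every r > rho0,
   uniformly in t, and e_m^(1/m) has limit at most r. *)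
Require Import Defs.
From HB Require Import structures.
From mathcomp Require Import all_boot all_order all_algebra.
From mathcomp Require Import all_classical all_reals all_analysis.
From mathcomp Require Import complex finmap.
From mathcomp Require Import ring lra zify.
Set Implicit Arguments.
Unset Strict Implicit.
Import Order.TTheory GRing.Theory Num.Theory.
Local Open Scope classical_set_scope.
Local Open Scope ring_scope.

(** * Successor sets and finite sums over them *)

Definition succs {V : choiceType} (A : set (V * V)) (a : V * V) : set (V * V) :=
  [set b | hash_rel A a b].

Definition succ_finite {V : choiceType} (A : set (V * V)) : Prop :=
  forall a, finite_set (succs A a).

Definition sym_arcs {V : choiceType} (A : set (V * V)) : Prop :=
  forall u v, A (u, v) -> A (v, u).

Definition rev_fun {V T : Type} (x : V * V -> T) : V * V -> T :=
  fun a => x (rev_arc a).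

Lemma rev_arcK {V : Type} : involutive (@rev_arc V).
Proof. by case. Qed.

Lemma succ_finite_lf {V : choiceType} (E : set (V * V)) :
  locally_finite E -> succ_finite E.
Proof.
move=> lf a; apply: (@sub_finite_set _ _ (pair a.2 @` [set w | E (a.2, w)])).
  by case=> u w [_ [+ [/= -> _]]] => Eb; exists w.
exact/finite_image/lf.
Qed.

Lemma succsS {V : choiceType} (A B : set (V * V)) a :
  A `<=` B -> succs A a `<=` succs B a.
Proof. by move=> AB b [Aa [Ab h]]; split; [exact: AB | split; [exact: AB|]]. Qed.

Lemma succ_finiteS {V : choiceType} (A B : set (V * V)) :
  A `<=` B -> succ_finite B -> succ_finite A.
Proof. by move=> AB fB a; apply: sub_finite_set (fB a); exact: succsS. Qed.

Lemma finite_succ_finite {V : choiceType} (A : set (V * V)) :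
  finite_set A -> succ_finite A.
Proof. by move=> fA a; apply: sub_finite_set fA => b [_ []]. Qed.

Lemma mem_succs {V : choiceType} (A : set (V * V)) a b : succ_finite A ->
  reflect (hash_rel A a b) (b \in fset_set (succs A a)).
Proof.
move=> fA; rewrite in_fset_set//.
by apply: (iffP idP); [apply: set_mem | apply: mem_set].
Qed.

(** A finitely supported sum is 0 by convention when its support is infinite; finite successor sets
    exclude that case. The ring is arbitrary because the eigenvalue equation lives in [R[i]] and the
    operator in [R]. *)
Lemma hash_sumE {V : choiceType} {K : pzRingType} (A : set (V * V))
    (x : V * V -> K) a : succ_finite A ->
  \sum_(b \in A) hashimoto A a b * x b = \sum_(b <- fset_set (succs A a)) x b.
Proof.
move=> fA; rewrite -fsbig_finite; last exact: fA.
rewrite -(@fsbig_widen _ _ _ _ (succs A a) A); last 2 first.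
- by move=> b [_ []].
- by move=> b [_ nh]; rewrite /= /hashimoto asboolF ?mul0r.
by apply: eq_fsbigr => b /set_mem h; rewrite /hashimoto asboolT ?mul1r.
Qed.

Lemma hash_opE {R : realType} {V : choiceType} (A : set (V * V))
    (x : V * V -> R) a : succ_finite A ->
  hash_op A x a = \sum_(b <- fset_set (succs A a)) x b.
Proof. exact: hash_sumE. Qed.

Lemma ler_sum_fsubset {K : numDomainType} {T : choiceType} (F G : {fset T})
    (f g : T -> K) : (F `<=` G)%fset ->
  (forall i, i \in F -> f i <= g i) -> (forall i, i \in G -> 0 <= g i) ->
  \sum_(i <- F) f i <= \sum_(i <- G) g i.
Proof.
move=> FG fg g0; pose h i := if i \in F then f i else 0.
have -> : \sum_(i <- F) f i = \sum_(i <- F) h i.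
  by rewrite big_seq [RHS]big_seq; apply: eq_bigr => i iF; rewrite /h iF.
rewrite (big_fset_incl _ FG); last by move=> i _ /negPf iF; rewrite /h iF.
rewrite big_seq [leRHS]big_seq; apply: ler_sum => i iG.
by rewrite /h; case: ifP => [/fg|_] //; exact: g0.
Qed.

(** * Positivity, monotonicity and linearity of the Hashimoto operator *)

Section HashOp.
Context {R : realType} {V : choiceType}.
Implicit Types (A B : set (V * V)) (x y : V * V -> R).

Lemma hash_op_le A B x y a : A `<=` B -> succ_finite B ->
  (forall b, A b -> x b <= y b) -> (forall b, B b -> 0 <= y b) ->
  hash_op A x a <= hash_op B y a.
Proof.
move=> AB fB xy y0; have fA := succ_finiteS AB fB; rewrite !hash_opE//.
apply: ler_sum_fsubset.
- apply/fsubsetP => b /(mem_succs _ _ fA) h; apply/(mem_succs _ _ fB).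
  exact: succsS h.
- by move=> b /(mem_succs _ _ fA)[_ [Ab _]]; exact: xy.
- by move=> b /(mem_succs _ _ fB)[_ [Bb _]]; exact: y0.
Qed.

Lemma hash_op_ge0 B y a : succ_finite B -> (forall b, B b -> 0 <= y b) ->
  0 <= hash_op B y a.
Proof.
move=> fB y0; rewrite hash_opE// big_seq; apply: sumr_ge0 => b.
by move=> /(mem_succs _ _ fB)[_ [Bb _]]; exact: y0.
Qed.

Lemma hash_op_out A x a : ~ A a -> hash_op A x a = 0.
Proof.
by move=> nA; apply: fsbig1 => b _; rewrite /hashimoto asboolF ?mul0r// => -[].
Qed.

Lemma iter_hash_op_ge0 B y n a : succ_finite B -> (forall b, B b -> 0 <= y b) ->
  B a -> 0 <= iter n (hash_op B) y a.
Proof.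
by move=> fB y0; elim: n a => [|n IH] a Ba /=; [exact: y0|exact: hash_op_ge0].
Qed.

(** Matrix entries are nonnegative and can only grow with the arc set. This is how a subgraph is
    compared with a larger graph. *)
Lemma iter_hash_op_le A B x y n a : A `<=` B -> succ_finite B ->
  (forall b, A b -> x b <= y b) -> (forall b, B b -> 0 <= y b) -> A a ->
  iter n (hash_op A) x a <= iter n (hash_op B) y a.
Proof.
move=> AB fB xy y0; elim: n a => [|n IH] a Aa /=; first exact: xy.
by apply: hash_op_le => // b Bb; exact: iter_hash_op_ge0.
Qed.

Lemma hash_op_sum A (I : Type) (r : seq I) (c : I -> R) (z : I -> V * V -> R) a :
  succ_finite A ->
  hash_op A (fun b => \sum_(i <- r) c i * z i b) a =
  \sum_(i <- r) c i * hash_op A (z i) a.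
Proof.
move=> fA; rewrite hash_opE// exchange_big/=; apply: eq_bigr => i _.
by rewrite hash_opE// mulr_sumr.
Qed.

Lemma iter_hash_op_sum A (I : Type) (r : seq I) (c : I -> R)
    (z : I -> V * V -> R) n a : succ_finite A ->
  iter n (hash_op A) (fun b => \sum_(i <- r) c i * z i b) a =
  \sum_(i <- r) c i * iter n (hash_op A) (z i) a.
Proof.
move=> fA; elim: n a => //= n IH a; rewrite -hash_op_sum//.
by congr (hash_op A _ a); apply/funext => b; rewrite IH.
Qed.

Lemma iter_hash_opZ A c x n a : succ_finite A ->
  iter n (hash_op A) (fun b => c * x b) a = c * iter n (hash_op A) x a.
Proof.
move=> fA; have := iter_hash_op_sum [:: tt] (fun=> c) (fun=> x) n a fA.
rewrite big_seq1 => <-; congr (iter n _ _ a).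
by apply/funext => b; rewrite big_seq1.
Qed.

Lemma normr_iter_hash_op A x n a : succ_finite A ->
  `|iter n (hash_op A) x a| <= iter n (hash_op A) (fun b => `|x b|) a.
Proof.
move=> fA; elim: n a => //= n IH a; rewrite hash_opE//.
apply: le_trans (ler_norm_sum _ _ _) _; rewrite hash_opE//.
by apply: ler_sum => b _.
Qed.

End HashOp.

(** * Geometric growth of orbits of a complex matrix *)

Lemma normc_ge0 {R : rcfType} (z : R[i]) : 0 <= Normc.normc z.
Proof. by case: z => a b; exact: sqrtr_ge0. Qed.

Lemma normc_real {R : rcfType} (a : R) : Normc.normc (real_complex R a) = `|a|.
Proof. by rewrite /= expr0n addr0 sqrtr_sqr. Qed.

Lemma ler_normcD {R : rcfType} (z w : R[i]) :
  Normc.normc (z + w) <= Normc.normc z + Normc.normc w.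
Proof. exact: le_normcD. Qed.

(* Peeling off one root [lam] of an annihilating polynomial turns the orbit
   [u k = v M^k] into a solution of [u (k+1) = lam (u k) + w k] where [w] is
   annihilated by the remaining factors. *)
Lemma annihilated_orbit_bound {R : rcfType} n (M : 'M[R[i]]_n.+1)
    (rs : seq R[i]) (r : R) (v : 'rV[R[i]]_n.+1) :
  0 < r -> (forall lam, lam \in rs -> Normc.normc lam < r) ->
  v *m (\prod_(lam <- rs) (M - lam%:M)) = 0 ->
  exists C, forall k j, Normc.normc ((v *m M ^+ k) 0 j) <= C * r ^+ k.
Proof.
move=> r0; elim: rs v => [|lam rs IH] v rsr.
  rewrite big_nil mulmx1 => ->; exists 0 => k j.
  by rewrite mul0mx mxE mul0r Normc.normc0.
rewrite big_cons mulmxA => /(IH _ _)[l ll|C CP].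
  by apply: rsr; rewrite inE ll orbT.
have lamr : Normc.normc lam < r by apply: rsr; rewrite inE eqxx.
have C0 : 0 <= C.
  by have := CP 0%N 0; rewrite expr0 mulr1; apply: le_trans; exact: normc_ge0.
pose S := \sum_j Normc.normc (v 0 j).
have S0 : 0 <= S by apply: sumr_ge0 => j _; exact: normc_ge0.
(* [X = C / (r - |lam|)] solves [|lam| X + C = r X], which closes the recursion; [S] pays for
   [k = 0]. *)
exists (S + C / (r - Normc.normc lam)) => k.
have D0 : 0 < r - Normc.normc lam by rewrite subr_gt0.
have CD0 : 0 <= C / (r - Normc.normc lam) by exact: divr_ge0 C0 (ltW D0).
elim: k => [|k IHk] j.
  rewrite expr0 mulmx1 mulr1; apply: (@le_trans _ _ S); last by rewrite lerDl.
  rewrite /S (bigD1 j)//= lerDl; apply: sumr_ge0 => i _; exact: normc_ge0.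
have -> : (v *m M ^+ k.+1) 0 j =
    lam * (v *m M ^+ k) 0 j + (v *m (M - lam%:M) *m M ^+ k) 0 j.
  rewrite mulmxBr mulmxBl mul_mx_scalar -scalemxAl exprS mulmxA.
  rewrite [X in _ = _ + X]mxE [X in _ = _ + (_ + X)]mxE.
  by rewrite [X in _ = _ + (_ - X)]mxE addrCA subrr addr0.
apply: le_trans (ler_normcD _ _) _.
rewrite Normc.normcM exprS.
have := lerD (ler_wpM2l (normc_ge0 lam) (IHk j)) (CP k j).
move=> /le_trans; apply.
rewrite -subr_ge0.
have -> : (S + C / (r - Normc.normc lam)) * (r * r ^+ k) -
   (Normc.normc lam * ((S + C / (r - Normc.normc lam)) * r ^+ k) + C * r ^+ k)
  = S * (r - Normc.normc lam) * r ^+ k by field; rewrite gt_eqF.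
exact: mulr_ge0 (mulr_ge0 S0 (ltW D0)) (exprn_ge0 _ (ltW r0)).
Qed.

Lemma near_geometric_lt {R : realType} (C g g' : R) : 0 < g -> g < g' ->
  \forall n \near \oo, C * g ^+ n < g' ^+ n.
Proof.
move=> g0 gg'; have g'0 := lt_trans g0 gg'.
have /cvg_geometric - /(_ C) : `|g / g'| < 1.
  by rewrite ger0_norm ?divr_ge0 ?ltW// ltr_pdivrMr ?mul1r.
move=> /cvgr_lt - /(_ 1 ltr01); apply: filterS => n /=.
by rewrite expr_div_n mulrA ltr_pdivrMr ?exprn_gt0// mul1r.
Qed.

(** * Spectral radius of a finite arc set *)

Section SpectralRadius.
Context {R : realType} {V : choiceType}.
Implicit Types (A B : set (V * V)) (x y : V * V -> R).

(** Triangle inequality in the eigenvector equation, whose coefficients are 0 or 1. Unlike the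
    equation, the resulting inequality survives enlarging the arc set. *)
Lemma hash_eigenvalue_sub A (lam : R[i]) : finite_set A ->
  hash_eigenvalue A lam ->
  exists y, [/\ forall a, 0 <= y a, exists a, A a /\ 0 < y a,
    forall a, ~ A a -> y a = 0 &
    forall a, A a -> Normc.normc lam * y a <= hash_op A y a].
Proof.
move=> fA [z [[a0 [Aa0 za0]] [zout ez]]].
have fsA := finite_succ_finite fA.
exists (fun a => Normc.normc (z a)); split.
- by move=> a; exact: normc_ge0.
- exists a0; split => //; rewrite lt_def normc_ge0 andbT.
  by apply: contra za0 => /eqP/Normc.eq0_normc ->.
- by move=> a /zout ->; exact: Normc.normc0.
- move=> a Aa; rewrite -Normc.normcM -ez// hash_sumE// hash_opE//.
  elim/big_ind2: _ => //; first by rewrite Normc.normc0.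
  by move=> u b w c ub wc; apply: le_trans (ler_normcD _ _) _; rewrite lerD.
Qed.

Lemma iter_hash_op_subeigen A y c n a : finite_set A -> 0 <= c ->
  (forall a, A a -> c * y a <= hash_op A y a) -> (forall a, 0 <= y a) ->
  A a -> c ^+ n * y a <= iter n (hash_op A) y a.
Proof.
move=> fA c0 cy y0; have fsA := finite_succ_finite fA.
elim: n a => [|n IH] a Aa; first by rewrite expr0 mul1r.
rewrite exprSr -mulrA.
apply: (le_trans (ler_wpM2l (exprn_ge0 n c0) (cy _ Aa))).
rewrite hash_opE// mulr_sumr /= hash_opE// big_seq [leRHS]big_seq.
by apply: ler_sum => b /(mem_succs _ _ fsA)[_ [Ab _]]; exact: IH.
Qed.

(** The [sup] of an unbounded set would default to 0. Summing [|lam| y <= T_A y] over [A], each row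
    contributes at most the total of [y], so the number of arcs is a bound. *)
Lemma hash_eigenvalue_bounded A : finite_set A ->
  exists N : R, forall lam, @hash_eigenvalue R V A lam -> Normc.normc lam <= N.
Proof.
move=> fA; exists (\sum_(a <- fset_set A) 1) => lam.
move=> /(hash_eigenvalue_sub fA)[y [y0 [a0 [Aa0 ya0]] _ ey]].
have fsA := finite_succ_finite fA.
pose S := \sum_(a <- fset_set A) y a.
have S0 : 0 < S.
  apply: lt_le_trans ya0 _.
  rewrite /S (big_fsetD1 a0) ?in_fset_set ?mem_set//= lerDl.
  by apply: sumr_ge0.
rewrite -(ler_pM2r S0) {1}/S mulr_sumr mulr_suml big_seq [leRHS]big_seq.
apply: ler_sum => a; rewrite in_fset_set// => /set_mem Aa; rewrite mul1r.
apply: le_trans (ey _ Aa) _; rewrite hash_opE//; apply: ler_sum_fsubset => //.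
apply/fsubsetP => b /(mem_succs _ _ fsA)[_ [Ab _]].
by rewrite in_fset_set//; exact: mem_set.
Qed.

Lemma le_spec_rad A lam : finite_set A -> @hash_eigenvalue R V A lam ->
  Normc.normc lam <= spec_rad A.
Proof.
move=> fA lamA; apply: ub_le_sup; last by exists lam.
have [N NP] := hash_eigenvalue_bounded fA.
by exists N => _ [mu muA <-]; exact: NP.
Qed.

(** The condition [0 <= r] covers the absence of eigenvalues, where the [sup] of the empty set is
    0. *)
Lemma spec_rad_le A (r : R) : 0 <= r ->
  (forall lam, hash_eigenvalue A lam -> Normc.normc lam <= r) ->
  spec_rad A <= r.
Proof.
move=> r0 h; rewrite /spec_rad; set S := (X in sup X).
have [->|/set0P S0] := eqVneq S set0; first by rewrite sup0.
by apply: ge_sup => // _ [lam lamA <-]; exact: h.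
Qed.

Lemma spec_rad_ge0 A : finite_set A -> 0 <= @spec_rad R V A.
Proof.
move=> fA; rewrite /spec_rad; set S := (X in sup X).
have [->|/set0P[_ [lam lamA _]]] := eqVneq S set0; first by rewrite sup0.
exact: le_trans (normc_ge0 lam) (le_spec_rad fA lamA).
Qed.

(** The characteristic polynomial splits over [R[i]]; its roots are eigenvalues, hence of modulus
    below [r], and by Cayley-Hamilton it annihilates every orbit. *)
Lemma iter_hash_op_bound A (r : R) x : finite_set A -> spec_rad A < r ->
  exists C, forall n a, A a -> `|iter n (hash_op A) x a| <= C * r ^+ n.
Proof.
move=> fA rA; have r0 : 0 < r := le_lt_trans (spec_rad_ge0 fA) rA.
have fsA := finite_succ_finite fA.
have [A0|/set0P[a0 Aa0]] := eqVneq A set0.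
  by exists 0 => n a; rewrite A0.
pose s : seq (V * V) := enum_fset (fset_set A).
have us : uniq s by exact: fset_uniq.
have sA a : (a \in s) = (a \in A) by rewrite -(in_fset_set fA).
have [n sn] : exists n, size s = n.+1.
  by case: (s) (sA a0) => [|c t _]; [rewrite (mem_set Aa0)|exists (size t)].
pose e (i : 'I_n.+1) := nth a0 s i.
have eA i : A (e i) by apply: set_mem; rewrite -sA mem_nth// sn.
have sumE (K : pzRingType) (f : V * V -> K) :
    \sum_(b \in A) f b = \sum_i f (e i).
  rewrite fsbig_finite//= -/s (big_nth a0) sn big_mkord//.
(* Transposed, because orbits are row vectors multiplied by [M] on the right. *)
pose M : 'M[R[i]]_n.+1 := \matrix_(i, j) hashimoto A (e j) (e i).
have [rs rsE] := closed_field_poly_normal (char_poly M).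
rewrite (monicP (char_poly_monic M)) scale1r in rsE.
have rsr lam : lam \in rs -> Normc.normc lam < r.
  move=> lamrs; apply: le_lt_trans rA; apply: le_spec_rad => //.
  have : eigenvalue M lam.
    by rewrite eigenvalue_root_char rsE root_prod_XsubC.
  case/eigenvalueP => v vM v0.
  pose z a := if a \in A then v 0 (inord (index a s)) else 0.
  have ze i : z (e i) = v 0 i.
    rewrite /z mem_set//; congr (v 0 _); apply: val_inj.
    by rewrite /= index_uniq ?sn// inordK.
  exists z; split; [|split].
  - have [i vi] : exists i, v 0 i != 0.
      apply/existsP; apply: contraR v0; rewrite negb_exists => /forallP v0.
      by apply/eqP/rowP => i; rewrite mxE; apply/eqP; have := v0 i; rewrite negbK.
    by exists (e i); rewrite ze.
  - by move=> a Aa; rewrite /z memNset.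
  - move=> a Aa; have /(nth_index a0) ea : a \in s by rewrite sA mem_set.
    have ils : (index a s < n.+1)%N by rewrite -sn index_mem sA mem_set.
    have -> : a = e (Ordinal ils) by rewrite /e /= ea.
    rewrite sumE ze; have /rowP/(_ (Ordinal ils)) := vM; rewrite !mxE => <-.
    by apply: eq_bigr => i _; rewrite !mxE ze mulrC.
have rsM v : v *m (\prod_(lam <- rs) (M - lam%:M)) = 0.
  have := Cayley_Hamilton M; rewrite rsE rmorph_prod/=.
  under eq_bigr do rewrite rmorphB/= horner_mx_X horner_mx_C.
  by move=> ->; rewrite mulmx0.
pose v : 'rV[R[i]]_n.+1 := \row_i real_complex R (x (e i)).
have [C CP] := annihilated_orbit_bound r0 rsr (rsM _ v).
exists C => k a Aa.
have /(nth_index a0) ea : a \in s by rewrite sA mem_set.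
have ils : (index a s < n.+1)%N by rewrite -sn index_mem sA mem_set.
have -> : a = e (Ordinal ils) by rewrite /e /= ea.
rewrite -normc_real; have := CP k (Ordinal ils); congr (Normc.normc _ <= _).
elim: k (Ordinal ils) => [|k IHk] j; first by rewrite mulmx1 mxE.
rewrite exprSr mulmxA mxE /= /hash_op sumE rmorph_sum.
apply: eq_bigr => i _; rewrite IHk rmorphM mulrC mxE; congr (_ * _).
by rewrite /hashimoto; case: ifP.
Qed.

(** An eigenvalue of [A] of modulus above [spec_rad B] would make the T_B-iterates of its
    subeigenvector grow at least like [|lam|^n], faster than an intermediate rate [r] permits. *)
Lemma spec_rad_leS A B : A `<=` B -> finite_set B ->
  @spec_rad R V A <= spec_rad B.
Proof.
move=> AB fB; have fA := sub_finite_set AB fB.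
apply: spec_rad_le; first exact: spec_rad_ge0.
move=> lam /(hash_eigenvalue_sub fA)[y [y0 [a [Aa ya0]] _ ey]].
rewrite leNgt; apply/negP => Blam.
pose r := (spec_rad B + Normc.normc lam) / 2.
have Br : spec_rad B < r by rewrite /r; lra.
have rlam : r < Normc.normc lam by rewrite /r; lra.
have r0 : 0 < r := le_lt_trans (spec_rad_ge0 fB) Br.
have [C CP] := iter_hash_op_bound y fB Br.
have [n /= _ /(_ n (leqnn n))] := near_geometric_lt (C / y a) r0 rlam.
rewrite mulrAC ltr_pdivrMr//; apply/negP; rewrite -leNgt.
apply: le_trans (iter_hash_op_subeigen n fA (normc_ge0 _) ey y0 Aa) _.
apply: le_trans (iter_hash_op_le n AB (finite_succ_finite fB) _ _ Aa) _.
- by move=> b _; exact: lexx.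
- by move=> b _; exact: y0.
- exact: le_trans (ler_norm _) (CP n a (AB _ Aa)).
Qed.

End SpectralRadius.

(** * Cauchy-Schwarz for finite sums *)

Lemma cauchy_schwarz_seq {R : realFieldType} {T : Type} (s : seq T)
    (x y : T -> R) :
  (\sum_(i <- s) x i * y i) ^+ 2 <=
  (\sum_(i <- s) x i ^+ 2) * (\sum_(i <- s) y i ^+ 2).
Proof.
elim: s => [|i s IH]; first by rewrite !big_nil expr0n mul0r.
rewrite !big_cons; move: IH.
have : 0 <= \sum_(i <- s) x i ^+ 2 by apply: sumr_ge0 => j _; exact: sqr_ge0.
have : 0 <= \sum_(i <- s) y i ^+ 2 by apply: sumr_ge0 => j _; exact: sqr_ge0.
set P := \sum_(i <- s) x i ^+ 2; set Q := \sum_(i <- s) y i ^+ 2.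
set S := \sum_(i <- s) x i * y i; move: (x i) (y i) => u v Q0 P0 SPQ.
suff : 2 * (S * (u * v)) <= P * v ^+ 2 + u ^+ 2 * Q.
  by move: SPQ; rewrite !expr2; nra.
(* A nonpositive left side is immediate; a positive one may be squared, and then [S^2 <= P Q] and
   [(P v^2 - u^2 Q)^2 >= 0] suffice. *)
have [X0|X0] := leP (S * (u * v)) 0.
  apply: le_trans (_ : 0 <= _); first by lra.
  by rewrite addr_ge0// mulr_ge0// sqr_ge0.
rewrite -(@ler_pXn2r _ 2)// ?nnegrE; last 2 first.
- by lra.
- by rewrite addr_ge0// mulr_ge0// sqr_ge0.
have H : S ^+ 2 * (u * v) ^+ 2 <= P * Q * (u * v) ^+ 2.
  by rewrite ler_wpM2r// sqr_ge0.
have := sqr_ge0 (P * v ^+ 2 - u ^+ 2 * Q).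
by move: H; rewrite !expr2; nra.
Qed.

Lemma sqr_sum_le {R : realFieldType} {T : Type} (s : seq T) (y : T -> R) :
  (\sum_(i <- s) y i) ^+ 2 <= (\sum_(i <- s) 1) * (\sum_(i <- s) y i ^+ 2).
Proof.
have := cauchy_schwarz_seq s (fun=> 1) y.
by under eq_bigr do rewrite mul1r; under [in leRHS]eq_bigr do rewrite expr1n.
Qed.

(** * Squared operator norms and the propagation of their finiteness *)

Section OpNorm.
Context {R : realType} {V : choiceType}.
Implicit Types (E : set (V * V)) (x y : V * V -> R).

(** Finite partial sums replace the extended-real [esum], so that estimates stay in [R]. *)
Definition l2_bounded E x (c : R) : Prop :=
  forall F : {fset V * V}, {in F, forall b, E b} ->
    \sum_(b <- F) x b ^+ 2 <= c.

Lemma l2sq_leP E x c : (l2sq E x <= c%:E)%E <-> l2_bounded E x c.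
Proof.
split=> [xc F FE|xc].
  rewrite -lee_fin -sumEFin; apply: le_trans xc.
  apply: ereal_sup_ubound; exists [set` F]; first by split.
  by rewrite -fsbig_seq.
apply: ge_ereal_sup => _ [A [fA AE] <-].
rewrite fsbig_finite//= sumEFin lee_fin; apply: xc => b.
by rewrite in_fset_set// => /set_mem; exact: AE.
Qed.

Lemma opnorm_sq_le E m c :
  (forall x, l2_bounded E x 1 -> l2_bounded E (iter m (hash_op E) x) c) ->
  (opnorm_sq E m <= c%:E)%E.
Proof.
move=> h; apply: ge_ereal_sup => _ [x x1 <-].
by apply/l2sq_leP/h/l2sq_leP.
Qed.

Lemma iter_hash_op_l2_bounded E m c d x : succ_finite E ->
  (opnorm_sq E m <= c%:E)%E -> 0 < d -> l2_bounded E x d ->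
  l2_bounded E (iter m (hash_op E) x) (c * d).
Proof.
move=> fE mc d0 xd F FE.
pose y b := (Num.sqrt d)^-1 * x b.
have sd : (Num.sqrt d) ^+ 2 = d by rewrite sqr_sqrtr// ltW.
have y1 : l2_bounded E y 1.
  move=> G GE; under eq_bigr do rewrite exprMn exprVn sd.
  by rewrite -mulr_sumr ler_pdivrMl// mulr1; exact: xd.
have : l2_bounded E (iter m (hash_op E) y) c.
  apply/l2sq_leP; apply: le_trans mc; apply: ereal_sup_ubound.
  by exists y => //; apply/l2sq_leP.
move=> /(_ F FE); under eq_bigr do rewrite iter_hash_opZ// exprMn exprVn sd.
by rewrite -mulr_sumr ler_pdivrMl// mulrC.
Qed.

Lemma opnorm_sq_submult E m n c d : succ_finite E -> 0 < d ->
  (opnorm_sq E m <= c%:E)%E -> (opnorm_sq E n <= d%:E)%E ->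
  (@opnorm_sq R V E (m + n) <= (c * d)%:E)%E.
Proof.
move=> fE d0 mc nd; apply: opnorm_sq_le => x x1; rewrite iterD.
apply: iter_hash_op_l2_bounded => //.
by rewrite -[d]mulr1; exact: iter_hash_op_l2_bounded.
Qed.

Lemma opnorm_sq_ge0 E m : (0 <= @opnorm_sq R V E m)%E.
Proof.
apply: (@le_trans _ _ (l2sq E (iter m (hash_op E) (fun=> 0 : R)))).
  by apply: esum_ge0 => b _; rewrite lee_fin sqr_ge0.
apply: ereal_sup_ubound; exists (fun=> 0) => //=; apply/l2sq_leP => F _.
by rewrite big1 ?ler01// => b _; rewrite expr0n.
Qed.

Definition delta_fun (b : V * V) : V * V -> R := fun a => (a == b)%:R.

Lemma l2_bounded_delta E b : l2_bounded E (delta_fun b) 1.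
Proof.
move=> F _; have [bF|bF] := boolP (b \in F).
  rewrite (big_fsetD1 b)//= /delta_fun eqxx expr1n big_seq big1 ?addr0// => a.
  by rewrite in_fsetD1 => /andP[/negPf -> _]; rewrite expr0n.
rewrite big_seq big1 ?ler01// => a aF; rewrite /delta_fun.
by case: eqP aF bF => [-> ->|]//; rewrite expr0n.
Qed.

(** A nonzero value forces a walk of [k] steps from [a] to some [b], and the corresponding entry of
    H^k counts such walks. *)
Lemma iter_hash_op_neq0 E k x a : succ_finite E -> E a ->
  iter k (hash_op E) x a != 0 ->
  exists2 b, E b & 1 <= iter k (hash_op E) (delta_fun b) a.
Proof.
move=> fE; elim: k a => [|k IH] a Ea /= xa.
  by exists a => //; rewrite /delta_fun eqxx.
have [b ab xb] : exists2 b, b \in fset_set (succs E a) &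
    iter k (hash_op E) x b != 0.
  apply: contrapT => nb; case/negP: xa; rewrite hash_opE// big_seq big1// => b ab.
  by apply/eqP; apply: contrapT => xb; apply: nb; exists b => //; exact/negP.
have /(mem_succs _ _ fE)[_ [Eb _]] := ab.
have [c Ec ck] := IH b Eb xb; exists c => //.
rewrite hash_opE// (big_fsetD1 b)//=; apply: le_trans ck _; rewrite lerDl.
rewrite big_seq; apply: sumr_ge0 => d; rewrite in_fsetD1 => /andP[_].
move=> /(mem_succs _ _ fE)[_ [Ed _]]; apply: iter_hash_op_ge0 => // e _; exact: ler0n.
Qed.

(* Column [c] of [H^(m+1)] has entries at least 1 at all the predecessors of an
   arc [b] that starts a walk of [m] steps to [c], so their number is at
   most the squared norm of that column. *)
Lemma sum_preds_le E m n (D : R) x b (F : {fset V * V}) : succ_finite E ->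
  (opnorm_sq E m.+1 <= D%:E)%E -> (m < n)%N -> E b ->
  iter n (hash_op E) x b != 0 -> {in F, forall a, E a} ->
  \sum_(a <- F) hashimoto E a b <= D.
Proof.
move=> fE mD mn Eb; rewrite -(subnKC (ltnW mn)) iterD => xb FE.
have [c Ec cb] := iter_hash_op_neq0 fE Eb xb.
have := iter_hash_op_l2_bounded fE mD ltr01 (@l2_bounded_delta E c).
rewrite mulr1 => /(_ F FE); apply: le_trans; apply: ler_sum => a _.
rewrite /hashimoto; case: asboolP => [ab|_]; last exact: sqr_ge0.
rewrite exprn_ege1//= hash_opE//.
have bS : b \in fset_set (succs E a) by apply/mem_succs.
rewrite (big_fsetD1 b)//=; apply: le_trans cb _; rewrite lerDl.
rewrite big_seq; apply: sumr_ge0 => d; rewrite in_fsetD1 => /andP[_].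
move=> /(mem_succs _ _ fE)[_ [Ed _]]; apply: iter_hash_op_ge0 => // e _; exact: ler0n.
Qed.

Lemma sum_succs_hashimoto E a (G : {fset V * V}) (f : V * V -> R) :
  succ_finite E -> (fset_set (succs E a) `<=` G)%fset ->
  \sum_(b <- fset_set (succs E a)) f b = \sum_(b <- G) hashimoto E a b * f b.
Proof.
move=> fE SG; rewrite -(big_fset_incl _ SG).
  rewrite big_seq [RHS]big_seq; apply: eq_bigr => b /(mem_succs _ _ fE) ab.
  by rewrite /hashimoto asboolT// mul1r.
move=> b _ /negP nb; rewrite /hashimoto asboolF ?mul0r// => ab.
by apply: nb; apply/mem_succs.
Qed.

(** Cauchy-Schwarz over the successors of [a], of which there are at most [D + 1] unless all values
    vanish: if [b] is one with nonzero value, the reverses of the others are predecessors of [b],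
    and [sum_preds_le] counts these. *)
Lemma sqr_hash_op_le E m n (D : R) x a : succ_finite E ->
  sym_arcs E ->
  (opnorm_sq E m.+1 <= D%:E)%E -> (m < n)%N ->
  iter n.+1 (hash_op E) x a ^+ 2 <=
  (D + 1) * \sum_(b <- fset_set (succs E a)) iter n (hash_op E) x b ^+ 2.
Proof.
move=> fE symE mD mn; rewrite /= hash_opE//; set y := iter n _ x.
have D0 : 0 <= D.
  by rewrite -lee_fin; apply: le_trans mD; exact: opnorm_sq_ge0.
have [[b ab yb]|nb] := pselect (exists2 b, b \in fset_set (succs E a) & y b != 0).
  have := sqr_sum_le (fset_set (succs E a)) y.
  move=> /le_trans; apply; apply: ler_wpM2r.
    by apply: sumr_ge0 => c _; exact: sqr_ge0.
  have /(mem_succs _ _ fE)[Ea [Eb [eab nab]]] := ab.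
  pose S := (fset_set (succs E a) `\ b)%fset.
  pose F : {fset V * V} := (@rev_arc V @` S)%fset.
  have FE : {in F, forall c, E c}.
    move=> d /imfsetP[c /= + ->]; rewrite in_fsetD1 => /andP[_].
    by move=> /(mem_succs _ _ fE)[_ [Ec _]]; apply: symE; case: c Ec.
  have := sum_preds_le fE mD mn Eb yb FE.
  rewrite big_imfset; last by move=> c d _ _; exact: (can_inj rev_arcK).
  rewrite [X in _ -> X <= _](big_fsetD1 b)//= addrC lerD2r; apply: le_trans.
  rewrite big_seq [leRHS]big_seq; apply: ler_sum => c cS.
  move: (cS); rewrite in_fsetD1 => /andP[cb /(mem_succs _ _ fE)].
  move=> [_ [Ec [eac _]]]; rewrite /hashimoto asboolT//; split.
    by apply: FE; apply/imfsetP; exists c.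
  split=> //; split; first by rewrite /= -eac.
  by rewrite rev_arcK => bc; rewrite bc eqxx in cb.
rewrite big_seq big1 => [|b ab].
  rewrite expr0n; apply: mulr_ge0; first by lra.
  by apply: sumr_ge0 => c _; exact: sqr_ge0.
by apply/eqP; apply: contrapT => yb; apply: nb; exists b => //; exact/negP.
Qed.

(** A Schur test with row bound [D + 1] and column bound [D]. Columns where [y] vanishes contribute
    nothing, so the predecessor count is used only where it is available. *)
Lemma l2_bounded_hash_op E m n (D c : R) x : succ_finite E ->
  sym_arcs E ->
  (opnorm_sq E m.+1 <= D%:E)%E -> (m < n)%N ->
  l2_bounded E (iter n (hash_op E) x) c ->
  l2_bounded E (iter n.+1 (hash_op E) x) ((D + 1) * (D * c)).
Proof.
move=> fE symE mD mn yc F FE; set y := iter n _ x in yc.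
have D0 : 0 <= D.
  by rewrite -lee_fin; apply: le_trans mD; exact: opnorm_sq_ge0.
have fG : finite_set (\bigcup_(a in [set` F]) succs E a).
  by apply: bigcup_finite => // a _; exact: fE.
pose G := fset_set (\bigcup_(a in [set` F]) succs E a).
have GE : {in G, forall b, E b}.
  by move=> b; rewrite in_fset_set// => /set_mem[a _ [_ []]].
have SG a : a \in F -> (fset_set (succs E a) `<=` G)%fset.
  move=> aF; apply/fsubsetP => b /(mem_succs _ _ fE) ab.
  by rewrite in_fset_set//; apply/mem_set; exists a.
apply: (@le_trans _ _ (\sum_(a <- F) (D + 1) *
    \sum_(b <- G) hashimoto E a b * y b ^+ 2)).
  rewrite big_seq [leRHS]big_seq; apply: ler_sum => a aF.
  rewrite -sum_succs_hashimoto//; last exact: SG.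
  exact: sqr_hash_op_le mD mn.
rewrite -mulr_sumr ler_wpM2l//; first by lra.
rewrite exchange_big/=; apply: (@le_trans _ _ (\sum_(b <- G) D * y b ^+ 2)).
  rewrite big_seq [leRHS]big_seq; apply: ler_sum => b bG; rewrite -mulr_suml.
  have [->|yb] := eqVneq (y b) 0; first by rewrite expr0n !mulr0.
  apply: ler_wpM2r; first exact: sqr_ge0.
  exact: sum_preds_le mD mn (GE _ bG) yb FE.
by rewrite -mulr_sumr ler_wpM2l//; exact: yc.
Qed.

(** Submultiplicativity alone would give finiteness only at multiples of [m.+1]; one-step
    propagation reaches every later exponent. *)
Lemma opnorm_sq_fin E m n (D : R) : succ_finite E ->
  sym_arcs E ->
  (opnorm_sq E m.+1 <= D%:E)%E -> (m < n)%N ->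
  exists c : R, (opnorm_sq E n <= c%:E)%E.
Proof.
move=> fE symE mD; elim: n => // n IH; rewrite ltnS leq_eqVlt.
case/predU1P => [<-|mn]; first by exists D.
have [c cn] := IH mn; exists ((D + 1) * (D * c)).
apply: opnorm_sq_le => x x1; apply: (l2_bounded_hash_op fE symE mD mn).
by rewrite -[c]mulr1; exact: (iter_hash_op_l2_bounded fE cn ltr01 x1).
Qed.

End OpNorm.

(** * The limit of the norm roots as an infimum, and its comparison with finite spectral radii *)

Section SpectralRadiusLimit.
Context {R : realType} {V : choiceType}.
Implicit Types (E : set (V * V)) (g : R).

(** This is [e_(n+1)^(1/(n+1))]: the factor 2 undoes the square in [opnorm_sq], and the shift avoids
    a zeroth root. *)
Definition opnorm_root E n : \bar R :=
  poweR (opnorm_sq E n.+1) (2 * n.+1%:R)^-1.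

Let sq_exp n : R := 2 * n.+1%:R.

Let sq_exp_gt0 n : 0 < sq_exp n.
Proof. by rewrite mulr_gt0. Qed.

Let powR_sq_exp n g : 0 <= g -> powR g (sq_exp n) = g ^+ (2 * n.+1).
Proof. by move=> g0; rewrite -powR_mulrn// natrM. Qed.

Lemma opnorm_root_le E n g : 0 <= g ->
  (opnorm_sq E n.+1 <= (g ^+ (2 * n.+1))%:E)%E -> (opnorm_root E n <= g%:E)%E.
Proof.
move=> g0 h; have s0 := sq_exp_gt0 n; rewrite /opnorm_root.
have -> : g%:E = poweR (g ^+ (2 * n.+1))%:E (sq_exp n)^-1.
  rewrite poweR_EFin -powR_sq_exp// -powRrM divff ?gt_eqF// powRr1//.
have inv0 : 0 <= (sq_exp n)^-1 by rewrite invr_ge0 ltW.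
by apply: (gt0_ler_poweR inv0 _ _ h);
  rewrite in_itv/= ?opnorm_sq_ge0 ?lee_fin ?exprn_ge0 ?leey.
Qed.

Lemma opnorm_sq_le_root E n g : 0 <= g -> (opnorm_root E n <= g%:E)%E ->
  (opnorm_sq E n.+1 <= (g ^+ (2 * n.+1))%:E)%E.
Proof.
move=> g0 h; have s0 := sq_exp_gt0 n.
have -> : opnorm_sq E n.+1 = poweR (opnorm_root E n) (sq_exp n).
  by rewrite /opnorm_root -poweRrM mulVf ?gt_eqF// poweRe1// opnorm_sq_ge0.
rewrite -powR_sq_exp// -poweR_EFin.
by apply: (gt0_ler_poweR (ltW s0) _ _ h);
  rewrite in_itv/= ?poweR_ge0 ?lee_fin ?g0 ?leey.
Qed.

(** Fekete's argument: subtracting [m.+1] repeatedly brings any exponent above [m] into a window of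
    [m.+1] consecutive exponents, over which one constant [M] serves. *)
Lemma opnorm_sq_growth E m g : succ_finite E ->
  sym_arcs E -> 0 < g ->
  (opnorm_sq E m.+1 <= (g ^+ (2 * m.+1))%:E)%E ->
  exists2 M, 0 < M & forall n, (m < n)%N ->
    (opnorm_sq E n <= (M * g ^+ (2 * n))%:E)%E.
Proof.
move=> fE symE g0 mg.
have gX n : 0 < g ^+ (2 * n) by exact: exprn_gt0.
have [M M0 MP] : exists2 M, 0 < M & forall n, (m < n < m + m.+2)%N ->
    (opnorm_sq E n <= (M * g ^+ (2 * n))%:E)%E.
  (* The window is built one exponent at a time, its upper end generalised to [m + k]. *)
  elim: (m.+2) => [|k [M M0 MP]]; first by exists 1 => // n; lia.
  have [mk|mk] := ltnP m (m + k)%N; last first.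
    by exists 1 => // n; have -> : k = 0%N; lia.
  have [c ck] := opnorm_sq_fin fE symE mg mk.
  (* The second summand absorbs the finite bound [c] at the new exponent [m + k]. *)
  exists (M + `|c| / g ^+ (2 * (m + k))) => [|n].
    by rewrite ltr_pwDl// divr_ge0// ltW.
  rewrite addnS ltnS [(n <= _)%N]leq_eqVlt andb_orr => /orP[/andP[_ /eqP ->]|].
    apply: le_trans ck _; rewrite lee_fin mulrDl divfK ?gt_eqF//.
    apply: le_trans (ler_norm c) _; rewrite lerDr.
    by rewrite mulr_ge0// ltW.
  move=> /MP /le_trans; apply; rewrite lee_fin ler_pM2r// lerDl.
  by rewrite divr_ge0// ltW.
exists M => //; elim/ltn_ind => n IH mn.
have [nm|nm] := ltnP n (m + m.+2); first by apply: MP; rewrite mn nm.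
have -> : n = (m.+1 + (n - m.+1))%N by lia.
rewrite mulnDr exprD mulrCA; apply: opnorm_sq_submult => //.
  exact: mulr_gt0.
by apply: IH; lia.
Qed.

Lemma near_opnorm_root_le E (M g g' : R) m : 0 < g -> g < g' ->
  (forall n, (m < n)%N -> (opnorm_sq E n <= (M * g ^+ (2 * n))%:E)%E) ->
  \forall n \near \oo, (opnorm_root E n <= g'%:E)%E.
Proof.
move=> g0 gg' h; have g'0 := lt_trans g0 gg'.
have gg2 : g ^+ 2 < g' ^+ 2 by rewrite ltr_pXn2r// ?nnegrE ltW.
have g20 : 0 < g ^+ 2 by exact: exprn_gt0.
have [N _ NP] := near_geometric_lt M g20 gg2.
near=> n; apply: opnorm_root_le; first exact: ltW.
have mn : (m < n.+1)%N by rewrite ltnS; near: n; exact: nbhs_infty_ge.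
apply: le_trans (h _ mn) _; rewrite lee_fin !exprM ltW//; apply: NP => /=.
by apply: leqW; near: n; exact: nbhs_infty_ge.
Unshelve. all: by end_near. Qed.

Lemma rho_l2E E : succ_finite E -> sym_arcs E ->
  rho_l2 E = ereal_inf (range (opnorm_root E)).
Proof.
move=> fE symE; apply/cvg_lim => //; set L := ereal_inf _.
have Lle n : (L <= opnorm_root E n)%E by apply: ereal_inf_lbound; exists n.
have L0 : (0 <= L)%E by apply: le_ereal_inf_tmp => _ [n _ <-]; exact: poweR_ge0.
have nearL g : (L < g%:E)%E -> \forall n \near \oo, (opnorm_root E n <= g%:E)%E.
  move=> Lg.
  (* The rate [h] leaves room on both sides: some root lies below it, and passing from [h] to [g]
     absorbs the constant [M]. *)
  have [h Lh hg] : exists2 h : R, (L < h%:E)%E & h < g.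
    move: Lg L0; case: (L) => [l||]//; rewrite lte_fin => lg _.
    by exists ((l + g) / 2); rewrite ?lte_fin; lra.
  have h0 : 0 < h by rewrite -lte_fin; exact: le_lt_trans Lh.
  have [_ [m _ <-] mh] := ereal_inf_lt Lh.
  have [M M0 MP] := opnorm_sq_growth fE symE h0 (opnorm_sq_le_root (ltW h0) (ltW mh)).
  exact: near_opnorm_root_le hg MP.
have [Loo|Lfin] := eqVneq L +oo%E.
  rewrite Loo (_ : (fun m => _) = cst +oo%E); first exact: cvg_cst.
  apply/funext => n; apply/eqP; rewrite -leye_eq -Loo; exact: Lle.
have /fineK Ll : L \is a fin_num by rewrite ge0_fin_numE// ltey.
rewrite -Ll; apply/fine_cvgP; split.
  have : (L < (fine L + 1)%:E)%E by rewrite -Ll lte_fin ltrDl.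
  move=> /nearL; apply: filterS => n nL; rewrite ge0_fin_numE ?poweR_ge0//.
  exact: le_lt_trans nL (ltry _).
apply/cvgrPdist_le => e e0.
have : (L < (fine L + e)%:E)%E by rewrite -[ltLHS]Ll lte_fin ltrDl.
move=> /nearL; apply: filterS => n nL /=.
have nf : opnorm_root E n \is a fin_num.
  by rewrite ge0_fin_numE ?poweR_ge0//; exact: le_lt_trans nL (ltry _).
have h1 : fine (opnorm_root E n) <= fine L + e by rewrite -lee_fin fineK.
have h2 : fine L <= fine (opnorm_root E n) by rewrite -lee_fin Ll fineK.
by rewrite distrC ger0_norm ?subr_ge0// lerBlDl.
Qed.

(** The subeigenvector is supported on the finite set [A], hence square-summable, and serves as a
    test vector: [|lam|^(n+1) y <= T_E^(n+1) y] on [A]. *)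
Lemma spec_rad_le_root E A n : succ_finite E -> finite_set A -> A `<=` E ->
  ((@spec_rad R V A)%:E <= opnorm_root E n)%E.
Proof.
move=> fE fA AE.
have : (0 <= opnorm_root E n)%E by exact: poweR_ge0.
case ne : (opnorm_root E n) => [g||] // => [g0|_]; last by rewrite leey.
rewrite !lee_fin in g0 *; apply: spec_rad_le => // lam.
move=> /(hash_eigenvalue_sub fA)[y [y0 [a0 [Aa0 ya0]] yout ey]].
have /(opnorm_sq_le_root g0) eg : (opnorm_root E n <= g%:E)%E by rewrite ne.
set F := fset_set A.
have FA b : b \in F -> A b by rewrite in_fset_set// => /set_mem.
have FE : {in F, forall b, E b} by move=> b /FA /AE.
pose d := \sum_(b <- F) y b ^+ 2.
have d0 : 0 < d.
  rewrite /d (big_fsetD1 a0) ?in_fset_set ?mem_set//= ltr_pwDl ?exprn_gt0//.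
  by apply: sumr_ge0 => b _; exact: sqr_ge0.
have yd : l2_bounded E y d.
  move=> G GE; rewrite /d.
  rewrite (big_fset_incl _ (fsubsetUl F G)).
    apply: ler_sum_fsubset; first exact: fsubsetUr.
      by move=> b _; exact: lexx.
    by move=> b _; exact: sqr_ge0.
  move=> b _; rewrite in_fset_set// => /negP nb; rewrite yout ?expr0n// => Ab.
  by apply: nb; exact: mem_set.
have iterF := iter_hash_op_l2_bounded fE eg d0 yd FE.
have lam0 := normc_ge0 lam.
have le_iter b : b \in F ->
    (Normc.normc lam ^+ n.+1 * y b) ^+ 2 <= iter n.+1 (hash_op E) y b ^+ 2.
  move=> bF; rewrite ler_sqr ?nnegrE; last 2 first.
  - by rewrite mulr_ge0// exprn_ge0.
  - by apply: iter_hash_op_ge0 => //; exact: FE.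
  apply: le_trans (iter_hash_op_subeigen n.+1 fA lam0 ey y0 (FA _ bF)) _.
  by apply: iter_hash_op_le => //; exact: FA.
rewrite -(@ler_pXn2r _ (2 * n.+1)%N)// ?nnegrE// -(ler_pM2r d0).
apply: le_trans iterF; rewrite {1}/d mulr_sumr big_seq [leRHS]big_seq.
by apply: ler_sum => b /le_iter; rewrite exprMn -exprM mulnC.
Qed.

End SpectralRadiusLimit.

(** * Log-convex sequences and norms of symmetric operators *)

Lemma log_convex_growth {R : realType} (u : nat -> R) (C q : R) : 0 < q ->
  (forall k, 0 <= u k) -> (forall k, u k.+1 ^+ 2 <= u k * u k.+2) ->
  (forall k, u k <= C * q ^+ k) -> u 1%N <= q * u 0%N.
Proof.
move=> q0 u0 lcu uC; rewrite leNgt; apply/negP => h.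
have u1 : 0 < u 1%N by apply: le_lt_trans h; rewrite mulr_ge0// ltW.
have u00 : 0 < u 0%N.
  rewrite lt_def u0 andbT; apply/negP => /eqP u00.
  have := lcu 0%N; rewrite u00 mul0r leNgt => /negP; apply.
  exact: exprn_gt0.
pose p := u 1%N / u 0%N.
have qp : q < p by rewrite /p ltr_pdivlMr.
have p0 : 0 < p := lt_trans q0 qp.
(* Log-convexity makes successive ratios nondecreasing, so a first ratio [p > q] persists and forces
   growth like [p^k], against the bound [C q^k]. *)
have ratio k : 0 < u k /\ p * u k <= u k.+1.
  elim: k => [|k [uk puk]]; first by rewrite /p divfK ?gt_eqF.
  have uk1 : 0 < u k.+1 by apply: lt_le_trans puk; exact: mulr_gt0.
  split=> //; rewrite -(ler_pM2l uk); apply: le_trans (lcu k).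
  by rewrite expr2 mulrCA mulrA ler_pM2r.
have low k : p ^+ k * u 0%N <= u k.
  elim: k => [|k IH]; first by rewrite mul1r.
  apply: le_trans (ratio k).2; rewrite exprS -mulrA.
  by rewrite ler_pM2l.
have [n _ /(_ n (leqnn n))] := near_geometric_lt (C / u 0%N) q0 qp.
rewrite mulrAC ltr_pdivrMr//; apply/negP; rewrite -leNgt.
exact: le_trans (low n) (uC n).
Qed.

Section SymmetricBound.
Context {R : realType} {V : choiceType}.
Implicit Types (A E : set (V * V)) (x y z : V * V -> R).

Definition dot A x y : R := \sum_(a <- fset_set A) x a * y a.

Lemma sym_arcs_rev A a : sym_arcs A -> A a -> A (rev_arc a).
Proof. by move=> sA; case: a => u v; exact: sA. Qed.

Lemma hash_rel_rev A a b : sym_arcs A ->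
  hash_rel A a b -> hash_rel A (rev_arc b) (rev_arc a).
Proof.
move=> sA [Aa [Ab [ab ba]]]; split; first exact: sym_arcs_rev.
split; first exact: sym_arcs_rev.
by split=> //; rewrite rev_arcK => /esym.
Qed.

Lemma hashimoto_rev A a b : sym_arcs A ->
  hashimoto A (rev_arc b) (rev_arc a) = hashimoto A a b :> R.
Proof.
move=> sA; rewrite /hashimoto; congr (if _ then _ else _).
apply: asbool_equiv_eq; split; last exact: hash_rel_rev.
by move=> /(hash_rel_rev sA); rewrite !rev_arcK.
Qed.

Lemma sum_rev A (f : V * V -> R) : finite_set A -> sym_arcs A ->
  \sum_(a <- fset_set A) f (rev_arc a) = \sum_(a <- fset_set A) f a.
Proof.
move=> fA sA.
have imE : (@rev_arc V @` fset_set A)%fset = fset_set A.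
  apply/fsetP => a; apply/imfsetP/idP => [[b /= bA ->]|aA].
    move: bA; rewrite !in_fset_set// => /set_mem Ab.
    exact: mem_set (sym_arcs_rev sA Ab).
  exists (rev_arc a); rewrite ?rev_arcK//=.
  move: aA; rewrite !in_fset_set// => /set_mem Aa.
  exact: mem_set (sym_arcs_rev sA Aa).
rewrite -[in RHS]imE big_imfset//= => a b _ _.
exact: (can_inj rev_arcK).
Qed.

Lemma dot_rev A x y : finite_set A -> sym_arcs A ->
  dot A (rev_fun x) y = dot A x (rev_fun y).
Proof.
move=> fA sA; rewrite /dot -[LHS]sum_rev//; apply: eq_bigr => a _.
by rewrite /rev_fun rev_arcK.
Qed.

(** The adjoint of T_A is P T_A P, since reversing both arcs transposes the Hashimoto matrix. *)
Lemma dot_hash_op A x y : finite_set A -> sym_arcs A ->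
  dot A x (hash_op A y) = dot A (rev_fun (hash_op A (rev_fun x))) y.
Proof.
move=> fA sA.
have hE z a : hash_op A z a = \sum_(b <- fset_set A) hashimoto A a b * z b.
  by rewrite /hash_op fsbig_finite.
rewrite /dot; under eq_bigr do rewrite hE mulr_sumr.
rewrite exchange_big/=; apply: eq_bigr => b _.
rewrite /rev_fun hE mulr_suml -sum_rev//; apply: eq_bigr => a _.
by rewrite -[hashimoto A (rev_arc b) a]hashimoto_rev// rev_arcK mulrA [x _ * _]mulrC.
Qed.

Lemma dot_iter_hash_op A m x y : finite_set A -> sym_arcs A ->
  dot A x (iter m (hash_op A) y) =
  dot A (rev_fun (iter m (hash_op A) (rev_fun x))) y.
Proof.
move=> fA sA; have rK z : rev_fun (rev_fun z) = z :> (V * V -> R).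
  by apply/funext => a; rewrite /rev_fun rev_arcK.
elim: m x => [|m IH] x; first by rewrite /= rK.
by rewrite [in LHS]/= dot_hash_op// IH rK -iterSr.
Qed.

Lemma iter_hash_op_ge0T E y n a : succ_finite E -> (forall b, 0 <= y b) ->
  0 <= iter n (hash_op E) y a.
Proof.
by move=> fE y0; elim: n a => //= n IH a; apply: hash_op_ge0.
Qed.

Lemma le_iter_hash_op_path E z a s : succ_finite E -> (forall b, 0 <= z b) ->
  path (nb_step E) a s -> z (last a s) <= iter (size s) (hash_op E) z a.
Proof.
move=> fE z0; elim: s a => [|b s IH] a /=; first by rewrite lexx.
case/andP => /asboolP ab /IH le_b; rewrite hash_opE//.
have bS : b \in fset_set (succs E a) by apply/mem_succs.
rewrite (big_fsetD1 b)//=; apply: le_trans le_b _; rewrite lerDl.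
by apply: sumr_ge0 => c _; exact: iter_hash_op_ge0T.
Qed.

(* With [P = rev_fun] the operator [S = H_A^m P] is symmetric, and every jump
   of [P] from an arc to its reverse can be replaced by a walk in [B] of length
   at most [l], so that [S] is dominated by [sum_(j <= l) H_B^(m+j)]. *)
Lemma iter_hash_op_norm_le A B m l (r : R) x :
  finite_set A -> finite_set B -> A `<=` B -> sym_arcs A ->
  (forall a, A a -> exists s, [/\ path (nb_step B) a s,
     last a s = rev_arc a & (size s <= l)%N]) ->
  spec_rad B < r -> (forall a, 0 <= x a) ->
  \sum_(a <- fset_set A) iter m.+1 (hash_op A) x a ^+ 2 <=
  (\sum_(j < l.+1) r ^+ (m.+1 + j)) ^+ 2 * \sum_(a <- fset_set A) x a ^+ 2.
Proof.
move=> fA fB AB sA excursion Br x0.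
have r0 : 0 < r := le_lt_trans (spec_rad_ge0 fB) Br.
have fsA := finite_succ_finite fA; have fsB := finite_succ_finite fB.
set s := \sum_(j < l.+1) _.
have s0 : 0 < s.
  rewrite /s big_ord_recl ltr_pwDl ?exprn_gt0//.
  by apply: sumr_ge0 => j _; rewrite exprn_ge0// ltW.
pose S z := iter m.+1 (hash_op A) (rev_fun z).
(* Starting from the reversed vector gives [S z0 = T_A^(m+1) x], while [z0] and [x] have the same
   norm. *)
pose z0 := rev_fun x.
have z00 b : 0 <= z0 b by exact: x0.
have S0 k a : 0 <= iter k S z0 a.
  by elim: k a => //= k IH a; apply: iter_hash_op_ge0T => // b; exact: IH.
have dominated z a : (forall b, 0 <= z b) -> B a ->
    S z a <= \sum_(j < l.+1) 1 * iter (m.+1 + j) (hash_op B) z a.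
  (* Outside [A] the left side vanishes, the exponent [m.+1] being positive. *)
  move=> zge0 Ba; have [Aa|nA] := pselect (A a); last first.
    rewrite /S iterS hash_op_out//; apply: sumr_ge0 => j _; rewrite mul1r.
    exact: iter_hash_op_ge0T.
  under eq_bigr do rewrite iterD.
  rewrite -iter_hash_op_sum//; apply: iter_hash_op_le => // b Ab; last first.
    by apply: sumr_ge0 => j _; rewrite mul1r iter_hash_op_ge0T.
  have [w [wB wlast wl]] := excursion b Ab.
  rewrite /rev_fun -wlast; apply: le_trans (le_iter_hash_op_path fsB zge0 wB) _.
  have wl1 : (size w < l.+1)%N by [].
  rewrite (bigD1 (Ordinal wl1))//= mul1r lerDl; apply: sumr_ge0 => j _.
  by rewrite mul1r iter_hash_op_ge0T.
have [C CP] := iter_hash_op_bound z0 fB Br.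
(* With [n] free the induction absorbs powers of T_B: dominating one [S] raises [n] by [m+1+j] for
   each [j <= l] and costs the factor [s]. *)
have growth k n a : B a -> iter n (hash_op B) (iter k S z0) a <= C * s ^+ k * r ^+ n.
  elim: k n a => [|k IH] n a Ba.
    by rewrite expr0 mulr1; exact: le_trans (ler_norm _) (CP n a Ba).
  rewrite /=; apply: (@le_trans _ _ (iter n (hash_op B) (fun b =>
      \sum_(j < l.+1) 1 * iter (m.+1 + j) (hash_op B) (iter k S z0) b) a)).
    apply: iter_hash_op_le => // b Bb; first exact: dominated.
    by apply: sumr_ge0 => j _; rewrite mul1r iter_hash_op_ge0T.
  rewrite iter_hash_op_sum// exprS.
  have -> : C * (s * s ^+ k) * r ^+ n =
      \sum_(j < l.+1) C * s ^+ k * r ^+ (n + (m.+1 + j)).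
    under eq_bigr do rewrite exprD mulrA.
    by rewrite -mulr_sumr -/s; ring.
  apply: ler_sum => j _; rewrite mul1r.
  by have := IH (n + (m.+1 + j))%N a Ba; rewrite iterD.
pose u k := \sum_(a <- fset_set A) iter k S z0 a ^+ 2.
have Ssym y z : dot A (S y) z = dot A y (S z).
  rewrite /S [RHS]dot_iter_hash_op// dot_rev//; congr (dot A _ _).
  by apply/funext => a; rewrite /rev_fun rev_arcK.
have uE k : u k = dot A (iter k S z0) (iter k S z0).
  by apply: eq_bigr => a _; rewrite expr2.
have -> : \sum_(a <- fset_set A) x a ^+ 2 = u 0%N.
  by rewrite /u /= -[LHS]sum_rev.
have -> : \sum_(a <- fset_set A) iter m.+1 (hash_op A) x a ^+ 2 = u 1%N.
  rewrite /u /S /=; apply: eq_bigr => a _; congr (hash_op A (iter m _ _) a ^+ 2).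
  by apply/funext => b; rewrite /z0 /rev_fun rev_arcK.
apply: (@log_convex_growth _ _ (\sum_(a <- fset_set A) C ^+ 2)).
- exact: exprn_gt0.
- by move=> k; apply: sumr_ge0 => a _; exact: sqr_ge0.
(* Symmetry of [S] moves one factor across: [u (k+1)] is the product of [S^k z0] with
   [S^(k+2) z0]. *)
- move=> k; rewrite [u k.+1]uE iterS Ssym -iterS; exact: cauchy_schwarz_seq.
- move=> k; rewrite mulr_suml /u big_seq [leRHS]big_seq; apply: ler_sum => a.
  rewrite in_fset_set// => /set_mem /AB Ba.
  have := growth k 0%N a Ba; rewrite expr0 mulr1 /= => h.
  rewrite -exprM mulnC exprM -exprMn ler_sqr ?nnegrE//.
  exact: le_trans (S0 k a) h.
Qed.

End SymmetricBound.

(** * Passing from the exhausting subgraphs to the whole graph *)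

Section Exhaustion.
Context {R : realType} {V : choiceType} (E : set (V * V))
  (ES : nat -> set (V * V)) (fE : succ_finite E)
  (ESE : forall t, ES t `<=` E) (ESS : forall t, ES t `<=` ES t.+1)
  (ES_cover : forall a, E a -> exists t, ES t a).

Lemma exhaustion_homo s t : (s <= t)%N -> ES s `<=` ES t.
Proof.
move=> /subnKC <-; elim: (t - s)%N => [|k IH]; first by rewrite addn0.
by rewrite addnS; apply: subset_trans IH _; exact: ESS.
Qed.

Lemma near_exhaustion a : E a -> \forall t \near \oo, ES t a.
Proof. by move=> /ES_cover[s sa]; exists s => // t /= /exhaustion_homo; apply. Qed.

Lemma near_hash_rel a b :
  hash_rel E a b -> \forall t \near \oo, hash_rel (ES t) a b.
Proof.
move=> [/near_exhaustion Ea [/near_exhaustion Eb ab]].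
by move: Ea Eb; apply: filterS2 => t ta tb.
Qed.

Lemma near_all_fset (F : {fset V * V}) (P : V * V -> nat -> Prop) :
  (forall a, a \in F -> \forall t \near \oo, P a t) ->
  \forall t \near \oo, forall a, a \in F -> P a t.
Proof.
move=> FP.
have [N _ NP] := @filter_bigI nat _ F (fun a => [set t | P a t]) \oo _ FP.
by exists N => // t Nt a aF; exact: NP.
Qed.

(** Only finitely many walks of [m] steps leave [a], so equality holds as soon as all their arcs are
    present. *)
Lemma near_iter_hash_op (x : V * V -> R) m a : E a ->
  \forall t \near \oo, iter m (hash_op (ES t)) x a = iter m (hash_op E) x a.
Proof.
elim: m a => [|m IH] a Ea; first by apply: nearW.
have near_succ b : b \in fset_set (succs E a) -> \forall t \near \oo,
    hash_rel (ES t) a b /\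
    iter m (hash_op (ES t)) x b = iter m (hash_op E) x b.
  move=> /(mem_succs _ _ fE) ab; have [_ [/IH Hb _]] := ab.
  by move: (near_hash_rel ab) Hb; apply: filterS2.
move: (near_all_fset near_succ); apply: filterS => t tP /=.
have ft : succ_finite (ES t) := succ_finiteS (@ESE t) fE.
rewrite !hash_opE//.
have -> : fset_set (succs (ES t) a) = fset_set (succs E a).
  apply/fsetP => b; apply/(mem_succs _ _ ft)/idP => [ab|/tP[]//].
  by apply/mem_succs => //; exact: succsS ab.
by rewrite big_seq [RHS]big_seq; apply: eq_bigr => b /tP[].
Qed.

Lemma near_path a s : path (nb_step E) a s ->
  \forall t \near \oo, path (nb_step (ES t)) a s.
Proof.
elim: s a => [|b s IH] a /=; first by move=> _; apply: nearW.
case/andP => /asboolP/near_hash_rel ab /IH bs.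
by move: ab bs; apply: filterS2 => t tab ->; rewrite andbT; exact/asboolP.
Qed.

(** Finitely many arcs need finitely many excursions, each a finite path, so a single subgraph
    eventually contains them all. *)
Lemma near_excursion l (A : set (V * V)) : finite_set A -> A `<=` E ->
  loc_strongly_connected E l ->
  \forall t \near \oo, forall a, A a -> exists s,
    [/\ path (nb_step (ES t)) a s, last a s = rev_arc a & (size s <= l)%N].
Proof.
move=> fA AE conn.
have : \forall t \near \oo, forall a, a \in fset_set A -> exists s,
    [/\ path (nb_step (ES t)) a s, last a s = rev_arc a & (size s <= l)%N].
  apply: near_all_fset => a; rewrite in_fset_set// => /set_mem/AE/conn.
  move=> [s [sE [sl sz]]]; move: (near_path sE); apply: filterS => t st.
  by exists s.
by apply: filterS => t tP a Aa; apply: tP; rewrite in_fset_set//; exact: mem_set.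
Qed.

(** A finite partial sum of the squared iterate already lives in some [ES t], where the symmetric
    bound applies with a constant independent of [t]. *)
Lemma opnorm_sq_connected_le l m (r : R) : (forall t, finite_set (ES t)) ->
  (forall t, sym_arcs (ES t)) -> loc_strongly_connected E l -> 0 <= r ->
  (forall t, spec_rad (ES t) < r) ->
  (opnorm_sq E m.+1 <= ((\sum_(j < l.+1) r ^+ (m.+1 + j)) ^+ 2)%:E)%E.
Proof.
move=> fES symES conn r0 ESr; apply: opnorm_sq_le => x x1 F FE.
pose y b := `|x b|.
have y0 b : 0 <= y b by exact: normr_ge0.
have near_eq : \forall t \near \oo, forall a, a \in F ->
    ES t a /\ iter m.+1 (hash_op (ES t)) y a = iter m.+1 (hash_op E) y a.
  apply: near_all_fset => a /FE Ea.
  by move: (near_exhaustion Ea) (near_iter_hash_op y m.+1 Ea); apply: filterS2.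
have [t _ /(_ t (leqnn t)) tP] := near_eq.
have [N _ NP] := near_excursion (fES t) (@ESE t) conn.
(* Two levels: [t] captures the iterate on [F], and the later [T] holds the excursions of [ES t]. *)
pose T := maxn N t.
have tT : ES t `<=` ES T by apply: exhaustion_homo; exact: leq_maxr.
have excursion := NP T (leq_maxl N t).
have norm_le := iter_hash_op_norm_le m (fES t) (fES T) tT (symES t) excursion (ESr T) y0.
apply: (@le_trans _ _ (\sum_(a <- fset_set (ES t))
    iter m.+1 (hash_op (ES t)) y a ^+ 2)).
  apply: ler_sum_fsubset.
  - apply/fsubsetP => a /tP[ta _]; rewrite in_fset_set//; exact: mem_set.
  - move=> a /tP[_ ->].
    rewrite -[leLHS]real_normK ?num_real// ler_sqr ?nnegrE//.
      exact: normr_iter_hash_op.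
    exact: iter_hash_op_ge0T.
  - by move=> a _; exact: sqr_ge0.
apply: le_trans norm_le _; rewrite -[leRHS]mulr1 ler_wpM2l ?sqr_ge0//.
under eq_bigr do rewrite real_normK ?num_real//.
by apply: x1 => a; rewrite in_fset_set// => /set_mem; exact: ESE.
Qed.

Lemma rho_l2_le_connected l (r : R) : (forall t, finite_set (ES t)) ->
  (forall t, sym_arcs (ES t)) -> sym_arcs E -> loc_strongly_connected E l ->
  0 < r -> (forall t, spec_rad (ES t) < r) -> (rho_l2 E <= r%:E)%E.
Proof.
move=> fES symES symE conn r0 ESr; rewrite rho_l2E//.
apply/lee_addgt0Pr => e e0.
have rre : r < r + e by rewrite ltrDl.
(* The excursion factor does not depend on [n], so the larger rate [r + e] absorbs it. *)
pose c := \sum_(j < l.+1) r ^+ j.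
have growth n : (0 < n)%N ->
    (opnorm_sq E n <= (c ^+ 2 * r ^+ (2 * n))%:E)%E.
  case: n => // n _.
  apply: le_trans (opnorm_sq_connected_le n fES symES conn (ltW r0) ESr) _.
  rewrite lee_fin; under eq_bigr do rewrite exprD.
  by rewrite -mulr_sumr exprMn mulrC -exprM [(2 * _)%N]mulnC.
have [n _ /(_ n (leqnn n)) nP] := near_opnorm_root_le r0 rre growth.
by apply: le_trans nP; apply: ereal_inf_lbound; exists n.
Qed.

End Exhaustion.

Theorem theorem4 (R : realType) (V : choiceType) (E : set (V * V))
  (VS : nat -> set V) (ES : nat -> set (V * V)) :
  is_graph E -> locally_finite E -> finite_exhaustion E VS ES ->
  exists rho0 : \bar R,
    ((fun t => (@spec_rad R V (ES t))%:E) @ \oo --> rho0) /\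
    (rho0 <= rho_l2 E)%E /\
    (forall l : nat, (0 < l)%N -> loc_strongly_connected E l ->
       rho0 = rho_l2 E).
Proof.
move=> [symE _] lfE [fVS [ESE [symES [ESV [_ [ESS [_ ES_cover]]]]]]].
have fE := succ_finite_lf lfE.
have fES t : finite_set (ES t).
  apply: sub_finite_set (finite_setX (fVS t) (fVS t)) => -[u v] /ESV[].
  by [].
set rho : nat -> \bar R := fun t => _.
exists (ereal_sup (range rho)).
have rho_le : (ereal_sup (range rho) <= rho_l2 E)%E.
  apply: ge_ereal_sup => _ [t _ <-]; rewrite rho_l2E//.
  by apply: le_ereal_inf_tmp => _ [n _ <-]; exact: spec_rad_le_root.
split; last split => //.
  apply: ereal_nondecreasing_cvgn; apply/nondecreasing_seqP => t.
  by rewrite lee_fin; exact: spec_rad_leS.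
move=> l _ conn; apply/eqP; rewrite eq_le rho_le /=.
have rho_ub t : (rho t <= ereal_sup (range rho))%E.
  by apply: ereal_sup_ubound; exists t.
(* In the finite case, adding [e] gives the strict bound on every [spec_rad (ES t)]; the value [-oo]
   is impossible because [rho 0] is real. *)
case rho0E : (ereal_sup (range rho)) rho_ub => [r||] rho_ub.
- apply/lee_addgt0Pr => e e0; rewrite -EFinD.
  have r0 : 0 <= r.
    by have := rho_ub 0%N; rewrite lee_fin; apply: le_trans; exact: spec_rad_ge0.
  apply: (rho_l2_le_connected fE ESE ESS ES_cover fES symES symE conn).
    exact: ltr_wpDl.
  by move=> t; have := rho_ub t; rewrite lee_fin => /le_lt_trans; apply; rewrite ltrDl.
- exact: leey.
- by have := rho_ub 0%N.
Qed.
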